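(* Let $G$ be a simple connected graph satisfying property (-SR) and let $m\ge 3$ be an integer. Then $F_2^m(G)$ satisfies property (-SR) if and only if $G$ is bipartite.
   Context: A graph is nonsingular if its adjacency matrix is nonsingular. A nonsingular graph $G$ has property (-SR) if for each eigenvalue $\lambda$ of $A(G)$, $-1/\lambda$ is also an eigenvalue of $A(G)$, with the same multiplicity as $\lambda$. The $m$-shadow graph $D_m(G)$ consists of $m$ copies $G_1,\dots,G_m$ of $G$, where each vertex $u$ in $G_i$ is joined to the neighbors of the corresponding vertex in $G_j$, $1\le i,j\le m$; its adjacency matrix is $J_m\otimes A(G)$ with $J_m$ the $m\times m$ all-ones matrix. $F_2^m(G)$ ($m\ge 3$) is obtained from $D_m(G)$ by deleting the edges inside $G_i$ for all $2\le i\le m$. Thus its adjacency matrix is $H\otimes A(G)$, where $H$ is the $m\times m$ 0-1 matrix with zeros exactly at positions $(i,i)$, $2\le i\le m$. *)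

(* Defs.v *)
From mathcomp Require Import all_boot all_order all_algebra all_field.

Set Implicit Arguments.
Unset Strict Implicit.
Unset Printing Implicit Defensive.

Import GRing.Theory.

Local Open Scope ring_scope.

Record sgraph := SGraph {
  vertex :> finType;
  adj : rel vertex;
  adj_sym : symmetric adj;
  adj_irr : irreflexive adj
}.

Definition connected_graph (G : sgraph) : Prop :=
  (0 < #|G|)%N /\ forall u v : G, connect (@adj G) u v.

Definition bipartite (G : sgraph) : Prop :=
  exists X : {set G}, forall u v : G, adj u v -> (u \in X) != (v \in X).

(* The entries are 0 and 1, so all the (complex) eigenvalues are algebraic
   numbers and working over algC loses none of them. *)
Definition adjmx (G : sgraph) : 'M[algC]_#|G| :=
  \matrix_(i, j) (adj (enum_val i) (enum_val j))%:R.

Definition nonsingular (G : sgraph) : Prop := adjmx G \in unitmx.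

Definition eigen_mult n (A : 'M[algC]_n) (a : algC) : nat :=
  mup a (char_poly A).

Definition minus_SR (G : sgraph) : Prop :=
  nonsingular G /\
  forall a : algC, eigenvalue (adjmx G) a ->
    eigenvalue (adjmx G) (- 1 / a) /\
    eigen_mult (adjmx G) (- 1 / a) = eigen_mult (adjmx G) a.

(* (i, u) is the copy of u in the i-th copy of G, counted from 0. *)
Definition shadow_adj (m : nat) (G : sgraph) : rel ('I_m * G) :=
  fun p q => adj p.2 q.2.

Lemma shadow_adj_sym m G : symmetric (@shadow_adj m G).
Proof. by move=> p q; rewrite /shadow_adj adj_sym. Qed.

Lemma shadow_adj_irr m G : irreflexive (@shadow_adj m G).
Proof. by move=> p; rewrite /shadow_adj adj_irr. Qed.

Definition shadow (m : nat) (G : sgraph) : sgraph :=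
  SGraph (@shadow_adj_sym m G) (@shadow_adj_irr m G).

(* The copies G_2, ..., G_m whose inner edges are deleted from the shadow
   graph are those of nonzero index. *)
Definition F2_adj (m : nat) (G : sgraph) : rel (shadow m G) :=
  fun p q => adj p q && ~~ ((p.1 == q.1) && (0 < p.1)%N).

Lemma F2_adj_sym m G : symmetric (@F2_adj m G).
Proof.
move=> p q; rewrite /F2_adj adj_sym [q.1 == _]eq_sym.
by case: eqP => // ->.
Qed.

Lemma F2_adj_irr m G : irreflexive (@F2_adj m G).
Proof. by move=> p; rewrite /F2_adj adj_irr. Qed.

Definition F2 (m : nat) (G : sgraph) : sgraph :=
  SGraph (@F2_adj_sym m G) (@F2_adj_irr m G).

(* Main.v *)
Require Import Defs.
From mathcomp Require Import all_boot all_order all_algebra all_field.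
From mathcomp Require Import fingroup perm mxtens ring zify.

(** The adjacency matrix of F_2^m(G) is the tensor product of a fixed m by m
    pattern with the adjacency matrix A of G ([adjmx_F2]).  With k = m - 1, the
    pattern has the eigenvalue -1 with multiplicity m - 2 and the two simple
    eigenvalues mu > 1 and -1/mu, the roots of x^2 - k x - 1
    ([F2_pattern_spectrum]).  So if S is the spectrum of G as a multiset, that
    of F_2^m(G) is the union of m - 2 copies of -S with mu S and -S/mu.

    Since x |-> -1/x preserves S, it preserves -S and turns mu S and -S/mu into
    S/mu and -mu S.  Therefore F_2^m(G) has -SR if and only if the multisets
    mu S + (-S/mu) and S/mu + (-mu S) coincide ([minus_SR_F2]).  In terms of the
    multiplicity s in S, this says that s(y) - s(-y) is invariant under
    multiplication of y by mu^2; as mu > 1 and S is finite, it holds only if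
    this difference vanishes, that is, if S is symmetric about 0
    ([balanced_even]).

    It remains that a connected graph has a symmetric spectrum if and only if
    it is bipartite.  A bipartition gives a diagonal sign matrix that
    conjugates A to -A ([bipartite_even_spectrum]).  Conversely, symmetry makes
    the trace of every odd power of A vanish, so G has no closed walk of odd
    length ([even_spectrum_no_odd_cycle]) and the parity of walks from a root
    is a 2-colouring ([no_odd_cycle_bipartite]). *)

Set Implicit Arguments.
Unset Strict Implicit.
Unset Printing Implicit Defensive.

Import Order.TTheory GRing.Theory Num.Theory.

Local Open Scope ring_scope.

(** * Multiplicities of eigenvalues and diagonalization *)

Lemma char_poly_similar n (P A B : 'M[algC]_n) :
  P \in unitmx -> P *m A = B *m P -> char_poly A = char_poly B.
Proof.
move=> Pu PA; pose PX := map_mx (@polyC algC) P.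
have detP : \det PX != 0.
  by rewrite det_map_mx polyC_eq0 -unitfE -unitmxE.
apply: (mulfI detP); rewrite [RHS]mulrC /char_poly -!det_mulmx; congr (\det _).
rewrite /char_poly_mx mulmxBr mulmxBl -!map_mxM PA.
by rewrite -scalar_mxC.
Qed.

Lemma eigen_mult_gt0 n (A : 'M[algC]_n) a :
  (0 < eigen_mult A a)%N = eigenvalue A a.
Proof.
rewrite eigenvalue_root_char /eigen_mult -XsubC_dvd ?dvdp_XsubCl //.
exact/monic_neq0/char_poly_monic.
Qed.

Lemma unitmx_eigen_mult n (A : 'M[algC]_n) :
  (A \in unitmx) = (eigen_mult A 0 == 0%N).
Proof.
rewrite -[RHS]negbK -lt0n eigen_mult_gt0 eigenvalue_root_char rootE.
by rewrite horner_coef0 char_poly_det mulf_eq0 signr_eq0 unitmxE unitfE.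
Qed.

(** The eigenvalues are listed by [d] with repetition, so that multiplicities
    become counts and traces of powers become power sums. *)
Definition diagonalizes n (P A : 'M[algC]_n) (d : 'I_n -> algC) :=
  P \in unitmx /\ P *m A = diag_mx (\row_i d i) *m P.

Lemma symmetric_diagonalizes n (A : 'M[algC]_n) :
    (forall i j, A i j = A j i) -> (forall i j, A i j \is Num.real) ->
  exists P d, diagonalizes P A d.
Proof.
move=> Asym Areal.
have /orthomx_spectralP defA : A \is normalmx.
  apply: symmetric_normalmx; last exact/mxOverP.
  apply/is_hermitianmxP; rewrite expr0 scale1r map_mx_id //.
  by apply/matrixP=> i j; rewrite mxE.
exists (spectralmx A), (spectral_diag A 0); split; first exact: spectral_unit.
have -> : \row_i spectral_diag A 0 i = spectral_diag A.
  by apply/rowP=> i; rewrite mxE.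
by rewrite {2}defA -mulmxA mulKVmx ?spectral_unit.
Qed.

Lemma eigen_mult_diagonalizes n (P A : 'M[algC]_n) d x :
  diagonalizes P A d -> eigen_mult A x = (\sum_i (d i == x))%N.
Proof.
case=> Pu PA; rewrite /eigen_mult (char_poly_similar Pu PA).
rewrite char_poly_trig ?diag_mx_is_trig //.
rewrite (eq_bigr (fun i => 'X - (d i)%:P)) => [|i _]; last first.
  by rewrite !mxE eqxx.
rewrite -(big_map d xpredT (fun y => 'X - y%:P)) mu_prod_XsubC.
by rewrite -sum1_count big_map big_mkcond /=; apply: eq_bigr=> i _; case: eqP.
Qed.

Lemma diagonalizes_exp n (P A : 'M[algC]_n) d k :
  diagonalizes P A d -> diagonalizes P (A ^+ k) (fun i => d i ^+ k).
Proof.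
case=> Pu PA; split=> //; elim: k => [|k IHk].
  rewrite expr0 mulmx1.
  suff -> : diag_mx (\row__ 1) = 1%:M :> 'M[algC]_n by rewrite mul1mx.
  by apply/matrixP=> i j; rewrite !mxE.
rewrite exprS mulmxE mulrA -mulmxE PA -mulmxA IHk mulmxA mulmx_diag.
by congr (diag_mx _ *m _); apply/rowP=> i; rewrite !mxE exprS.
Qed.

Lemma trace_diagonalizes n (P A : 'M[algC]_n) d :
  diagonalizes P A d -> \tr A = \sum_i d i.
Proof.
case=> Pu PA; rewrite -[A](mulKmx Pu) PA mulmxA mxtrace_mulC mulmxA mulmxV //.
by rewrite mul1mx mxtrace_diag; apply: eq_bigr=> i _; rewrite mxE.
Qed.

Lemma diagonalizes_tens m n (P A : 'M[algC]_m) (Q B : 'M[algC]_n) d e :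
    diagonalizes P A d -> diagonalizes Q B e ->
  diagonalizes (P *t Q) (A *t B)
    (fun k => d (mxtens_unindex k).1 * e (mxtens_unindex k).2).
Proof.
case=> Pu PA [Qu QB]; split.
  suff: (invmx P *t invmx Q) *m (P *t Q) = 1%:M by case/mulmx1_unit.
  rewrite tensmx_mul !mulVmx //; apply/matrixP=> k l.
  case: (mxtens_indexP k) (mxtens_indexP l) => i1 j1 [i2 j2].
  by rewrite tensmxE !mxE -natrM mulnb (can_eq (@mxtens_indexK _ _)) xpair_eqE.
rewrite tensmx_mul PA QB -tensmx_mul; congr (_ *m _); apply/matrixP=> k l.
case: (mxtens_indexP k) (mxtens_indexP l) => i1 j1 [i2 j2].
rewrite tensmxE !mxE mxtens_indexK (can_eq (@mxtens_indexK _ _)) xpair_eqE.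
by case: eqP; case: eqP; rewrite ?mulr0 ?mul0r.
Qed.

(** The eigenvalues of a tensor product are the products of eigenvalues, and
    [d i * e j] is [x] exactly when [e j] is [x / d i]. *)
Lemma eigen_mult_tens m n (P A : 'M[algC]_m) (Q B : 'M[algC]_n) d e x :
    diagonalizes P A d -> diagonalizes Q B e -> (forall i, d i != 0) ->
  eigen_mult (A *t B) x = (\sum_i eigen_mult B (x / d i))%N.
Proof.
move=> dA dB nz_d.
rewrite (eigen_mult_diagonalizes _ (diagonalizes_tens dA dB)).
under [RHS]eq_bigr do rewrite (eigen_mult_diagonalizes _ dB).
rewrite pair_big [RHS](reindex (@mxtens_unindex m n)); last first.
  by exists (@mxtens_index m n) => i _; rewrite (mxtens_indexK, mxtens_unindexK).
apply: eq_bigr => k _ /=; congr (nat_of_bool _).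
by rewrite mulrC; apply/eqP/eqP=> [<-|->]; rewrite ?mulfK ?divfK.
Qed.

(** Renaming the index set conjugates by a permutation matrix once the two
    sizes, which are only provably equal, have been identified. *)
Lemma eigen_mult_reindex m n (f : 'I_m -> 'I_n) (A : 'M[algC]_n) x :
  bijective f -> eigen_mult (mxsub f f A) x = eigen_mult A x.
Proof.
move=> bij_f; have eq_mn : m = n.
  by have /bij_eq_card := bij_f; rewrite !card_ord.
case: _ / eq_mn in A f bij_f *; rewrite /eigen_mult.
have inj_f := bij_inj bij_f.
have unit_s := unitmx_perm algC (perm inj_f)^-1%g.
rewrite (char_poly_similar (B := A) unit_s) //.
have -> : mxsub f f A = row_perm (perm inj_f) (col_perm (perm inj_f) A).
  by apply/matrixP=> i j; rewrite !mxE !permE.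
by rewrite -row_permE -row_permM mulVg row_perm1 col_permE.
Qed.

(** * The spectrum of the pattern matrix of F_2^m *)

(** The matrix written H in the adjacency matrix H (x) A of F_2^m. *)
Definition F2_pattern m : 'M[algC]_m :=
  \matrix_(i, j) (~~ ((i == j) && (0 < i)%N))%:R.

Lemma adjmx_F2 m (G : sgraph) :
  exists2 f : 'I_#|F2 m G| -> 'I_(m * #|G|),
    bijective f & adjmx (F2 m G) = mxsub f f (F2_pattern m *t adjmx G).
Proof.
pose f (k : 'I_#|F2 m G|) : 'I_(m * #|G|) :=
  mxtens_index ((enum_val k).1, enum_rank (enum_val k).2).
pose g (l : 'I_(m * #|G|)) : 'I_#|F2 m G| :=
  enum_rank ((mxtens_unindex l).1, enum_val (mxtens_unindex l).2).
exists f.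
  exists g => [k|l]; rewrite /f /g.
    rewrite mxtens_indexK /= enum_rankK -[RHS]enum_valK; congr enum_rank.
    by case: (enum_val k).
  rewrite enum_rankK /= enum_valK -[RHS]mxtens_unindexK; congr mxtens_index.
apply/matrixP=> k l; rewrite /f !mxE !mxtens_indexK /= !enum_rankK.
by rewrite -natrM mulnb andbC.
Qed.

Lemma F2_pattern_root k :
  (0 < k)%N -> exists2 mu : algC, 1 < mu & mu ^+ 2 = k%:R * mu + 1.
Proof.
move=> k_gt0; exists ((k%:R + sqrtC (k%:R ^+ 2 + 4)) / 2).
  rewrite ltr_pdivlMr ?ltr0n // mul1r.
  apply: (@lt_le_trans _ _ (1 + 2)); first by rewrite ltrDr ltr01.
  rewrite lerD ?ler1n // -[leLHS](sqrCK (ler0n _ 2)).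
  rewrite ler_sqrtC ?qualifE /= -?natrX -?natrD ?ler0n //.
  by rewrite ler_nat leq_addl.
have := sqrtCK (k%:R ^+ 2 + 4 : algC); set s := sqrtC _ => s2.
rewrite expr_div_n sqrrD s2; by field.
Qed.

(** For a row eigenvector [v] with entry sum [S], the eigenvalue equation in
    column [j] reads [S = (h + (j > 0)) v_j].  If [h != -1], all the entries
    are thus determined by [S], and adding them up gives a quadratic equation
    for [h], unless [S] and then [v] vanish. *)
Lemma eigenvalue_F2_pattern k h :
  eigenvalue (F2_pattern k.+1) h -> (h + 1) * (h ^+ 2 - k%:R * h - 1) = 0.
Proof.
case/eigenvalueP=> v vH nz_v; pose S := \sum_j v 0 j.
have Sv (j : 'I_k.+1) : S = (h + (0 < j)%N%:R) * v 0 j.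
  move/rowP/(_ j): vH; rewrite !mxE => vHj.
  rewrite mulrDl -vHj (bigD1 j) //= /S (bigD1 j) //= !mxE eqxx /=.
  rewrite [X in _ + X + _](eq_bigr (v 0)) => [|l /negPf nlj]; last first.
    by rewrite mxE nlj mulr1.
  by case: (0 < j)%N => /=; ring.
have [->|nz_h1] := eqVneq (h + 1) 0; first by rewrite mul0r.
have vS (j : 'I_k) : v 0 (lift ord0 j) = S / (h + 1).
  by rewrite (Sv (lift ord0 j)) mulrC mulKf.
have S0 : S = h * v 0 ord0 by rewrite (Sv ord0) addr0.
have : S = v 0 ord0 + k%:R * (S / (h + 1)).
  rewrite {1}/S big_ord_recl (eq_bigr _ (fun j _ => vS j)).
  by rewrite sumr_const card_ord mulr_natl.
have [Snull|nz_S] := eqVneq S 0.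
  rewrite Snull mul0r mulr0 addr0 => /esym v0; case/eqP: nz_v.
  apply/rowP=> j; rewrite mxE; case: (unliftP ord0 j) => [l|] -> //.
  by rewrite vS Snull mul0r.
move=> /(congr1 (fun x => x * (h * (h + 1)))); rewrite mulrDl.
have -> : v 0 ord0 * (h * (h + 1)) = S * (h + 1) by rewrite S0; ring.
have -> : k%:R * (S / (h + 1)) * (h * (h + 1)) = k%:R * S * h by field.
move=> eqS; apply: (mulfI nz_S); rewrite mulr0.
transitivity ((S * (h * (h + 1)) - (S * (h + 1) + k%:R * S * h)) * (h + 1)).
  by ring.
by rewrite eqS subrr mul0r.
Qed.

(** Let weights [a], [b], [c] sit at the points [-1], [x], [y].  Their moments
    of order 0, 1, 2 form a Vandermonde system, so the moments of the weights
    [x + y - 1], [1], [1] force these values.  The statement is symmetric in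
    [(b, x)] and [(c, y)]. *)
Lemma moments_determine_weight (a b c x y : algC) :
    x * y = -1 -> x != y -> x + y != 0 ->
    a + b + c = x + y + 1 -> - a + x * b + y * c = 1 ->
    a + x ^+ 2 * b + y ^+ 2 * c = (x + y + 1) ^+ 2 - (x + y) ->
  b = 1.
Proof.
move=> xy neq_xy nz_xy H0 H1 H2.
have Da : a = x + y - 1.
  apply: (mulIf nz_xy).
  transitivity ((a + x ^+ 2 * b + y ^+ 2 * c)
                - (x + y) * (- a + x * b + y * c) - (a + b + c)
                + (1 + x * y) * (b + c)); first by ring.
  by rewrite H0 H1 H2 xy; ring.
apply: (mulIf (x := x - y)); first by rewrite subr_eq0.
transitivity ((- a + x * b + y * c) - y * (a + b + c) + a * (1 + y)).
  by ring.
by rewrite H0 H1 Da; ring.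
Qed.

(** The eigenvalues of the pattern are [-1], [mu] and [-1 / mu]; the last two
    are simple because the traces of its powers 0, 1 and 2 fix the
    multiplicities.  The multiplicity [a] of [-1] is only asserted to exist:
    the eigenvalues that [-1] contributes to F_2^m are the opposites of those
    of G, and the map [x |-> -1 / x] permutes them if G has -SR. *)
Lemma F2_pattern_spectrum k mu :
    (0 < k)%N -> 1 < mu -> mu ^+ 2 = k%:R * mu + 1 ->
  exists P d, [/\ diagonalizes P (F2_pattern k.+1) d, forall i, d i != 0 &
    exists a, forall g : algC -> nat,
      (\sum_i g (d i) = g (-1)%R * a + g mu + g (- mu^-1)%R)%N].
Proof.
move=> k_gt0 mu_gt1 mu_root; set nu := - mu^-1.
have mu_gt0 : 0 < mu by apply: lt_trans mu_gt1.
have nz_mu : mu != 0 by rewrite gt_eqF.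
have nu_lt0 : nu < 0 by rewrite oppr_lt0 invr_gt0.
have Dk : k%:R = mu + nu.
  by apply: (mulIf nz_mu); rewrite mulrDl mulNr mulVf // -expr2 mu_root addrK.
have munu : mu * nu = -1 by rewrite mulrN mulfV.
have neq_m1mu : -1 != mu by rewrite lt_eqF // (lt_trans _ mu_gt0) // oppr_lt0.
have neq_munu : mu != nu by rewrite gt_eqF // (lt_trans nu_lt0).
have neq_m1nu : -1 != nu by rewrite eqr_opp eq_sym invr_eq1 gt_eqF.
have neqs := (negPf neq_m1mu, negPf neq_m1nu, negPf neq_munu,
  eq_sym mu (-1), eq_sym nu (-1), eq_sym nu mu).
have [P [d dH]] : exists P d, diagonalizes P (F2_pattern k.+1) d.
  apply: symmetric_diagonalizes => i j; last by rewrite mxE realn.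
  by rewrite !mxE [j == i]eq_sym; case: eqP => // ->.
have d_in i : [\/ d i = -1, d i = mu | d i = nu].
  have : eigenvalue (F2_pattern k.+1) (d i).
    rewrite -eigen_mult_gt0 (eigen_mult_diagonalizes _ dH).
    by rewrite (bigD1 i) //= eqxx.
  move/eigenvalue_F2_pattern/eqP; rewrite mulf_eq0 addr_eq0.
  case/orP=> [/eqP->|]; first by constructor 1.
  have -> : d i ^+ 2 - k%:R * d i - 1 = (d i - mu) * (d i - nu).
    by rewrite -munu Dk; ring.
  rewrite mulf_eq0 !subr_eq0 => /orP[]/eqP->; first by constructor 2.
  by constructor 3.
pose cnt r := (\sum_i (d i == r))%N.
have sum_d (R : pzSemiRingType) (F : algC -> R) :
    \sum_i F (d i)
    = F (-1) * (cnt (-1))%:R + F mu * (cnt mu)%:R + F nu * (cnt nu)%:R.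
  rewrite !natr_sum !mulr_sumr -!big_split /=; apply: eq_bigr => i _.
  by case: (d_in i) => ->; rewrite eqxx !neqs !(mulr0, mulr1) ?addr0 ?add0r.
have H0 := sum_d algC (fun=> 1).
have H1 := sum_d algC id.
have H2 := sum_d algC (fun x => x ^+ 2).
rewrite /= sumr_const card_ord in H0.
rewrite -(trace_diagonalizes dH) in H1.
rewrite -(trace_diagonalizes (diagonalizes_exp 2 dH)) in H2.
have row_sum (i : 'I_k.+1) : \sum_j F2_pattern k.+1 i j = k.+1%:R - (0 < i)%N%:R.
  rewrite (bigD1 i) //= (eq_bigr (fun=> 1)) => [|j /negPf nji]; last first.
    by rewrite mxE eq_sym nji.
  rewrite sumr_const cardC1 card_ord mxE eqxx -natr1 /=.
  by case: (0 < i)%N => /=; ring.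
have tr1 : \tr (F2_pattern k.+1) = 1.
  rewrite /mxtrace big_ord_recl big1 => [|i _]; rewrite !mxE ?eqxx ?addr0 //.
have sum_pos : \sum_(i < k.+1) (0 < i)%N%:R = k%:R :> algC.
  by rewrite big_ord_recl add0r (eq_bigr (fun=> 1)) // sumr_const card_ord.
have tr2 : \tr (F2_pattern k.+1 ^+ 2) = k.+1%:R ^+ 2 - k%:R.
  rewrite -sum_pos /mxtrace.
  transitivity (\sum_i \sum_j F2_pattern k.+1 i j).
    apply: eq_bigr=> i _; rewrite expr2 mxE; apply: eq_bigr => j _.
    rewrite !mxE [j == i]eq_sym.
    by case: eqP => [->|_]; case: (0 < j)%N; rewrite /= ?mulr1 ?mulr0.
  rewrite (eq_bigr _ (fun i _ => row_sum i)) sumrB sumr_const card_ord.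
  by rewrite sum_pos expr2 mulr_natl.
rewrite {}tr1 in H1; rewrite {}tr2 in H2.
move: (sum_d) H0 H1 H2; set a := cnt (-1); set b := cnt mu; set c := cnt nu.
rewrite -natr1 Dk => sum_dn H0 H1 H2.
have nz_sum : mu + nu != 0 by rewrite -Dk pnatr_eq0 -lt0n.
have Db : b%:R = 1 :> algC.
  apply: (@moments_determine_weight a%:R _ c%:R mu nu) => //.
  - by rewrite H0; ring.
  - by rewrite [RHS]H1; ring.
  - by rewrite H2; ring.
have Dc : c%:R = 1 :> algC.
  apply: (@moments_determine_weight a%:R _ b%:R nu mu) => //.
  - by rewrite mulrC.
  - by rewrite eq_sym.
  - by rewrite addrC.
  - by rewrite [nu + mu]addrC H0; ring.
  - by rewrite [RHS]H1; ring.
  - by rewrite [nu + mu]addrC H2; ring.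
exists P, d; split=> // [i|].
  by case: (d_in i) => ->; rewrite ?oppr_eq0 ?oner_eq0 ?invr_eq0.
exists a => g; rewrite sum_dn.
move/eqP: Db; move/eqP: Dc; rewrite !pnatr_eq1 => /eqP-> /eqP->.
by rewrite !mulr1 natn.
Qed.

(** * Property -SR of F_2^m in terms of the spectrum of G *)

Lemma adjmx_sym (G : sgraph) i j : adjmx G i j = adjmx G j i.
Proof. by rewrite !mxE adj_sym. Qed.

Lemma adjmx_diagonalizes (G : sgraph) : exists P d, diagonalizes P (adjmx G) d.
Proof.
by apply: symmetric_diagonalizes => i j; [exact: adjmx_sym | rewrite mxE realn].
Qed.

(** Inversion sends 0 to 0, so [a |-> - a^-1] is an involution of the whole
    field and the condition on eigenvalues extends to all numbers. *)
Lemma minus_SR_mult (G : sgraph) :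
  minus_SR G <->
  eigen_mult (adjmx G) 0 = 0%N /\
  forall a, eigen_mult (adjmx G) (- a^-1) = eigen_mult (adjmx G) a.
Proof.
rewrite /minus_SR /nonsingular unitmx_eigen_mult.
split=> [[/eqP s0 SR]|[s0 SR]]; (split=> [|a]; first by rewrite s0).
- have {}SR b : eigenvalue (adjmx G) b ->
      eigen_mult (adjmx G) (- b^-1) = eigen_mult (adjmx G) b.
    by case/SR=> _; rewrite mulNr mul1r.
  case a_eig: (eigenvalue (adjmx G) a); first exact: SR.
  case b_eig: (eigenvalue (adjmx G) (- a^-1)).
    by have := SR _ b_eig; rewrite invrN invrK opprK.
  move/negbT: a_eig; move/negbT: b_eig.
  by rewrite -!eigen_mult_gt0 -!eqn0Ngt => /eqP-> /eqP->.
by rewrite -!eigen_mult_gt0 mulNr mul1r SR.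
Qed.

Lemma eigen_mult_F2 k mu (G : sgraph) :
    (0 < k)%N -> 1 < mu -> mu ^+ 2 = k%:R * mu + 1 ->
  exists a, forall x, eigen_mult (adjmx (F2 k.+1 G)) x
    = (eigen_mult (adjmx G) (- x)%R * a + eigen_mult (adjmx G) (x / mu)%R
       + eigen_mult (adjmx G) (- (x * mu))%R)%N.
Proof.
move=> k_gt0 mu_gt1 mu_root.
have [P [d [dH nz_d [a sum_d]]]] := F2_pattern_spectrum k_gt0 mu_gt1 mu_root.
have [Q [e dA]] := adjmx_diagonalizes G.
have [f bij_f ->] := adjmx_F2 k.+1 G.
exists a => x; rewrite eigen_mult_reindex // (eigen_mult_tens _ dH dA nz_d).
rewrite (sum_d (fun h => eigen_mult (adjmx G) (x / h))).
by rewrite invrN1 mulrN1 invrN invrK mulrN.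
Qed.

(** The map [x |-> -1 / x] preserves the part [-S] of the spectrum of F_2^m
    and sends [mu S] to [S / mu] and [- S / mu] to [- mu S], where [S] is the
    spectrum of G.  Hence -SR for F_2^m compares the latter two parts only. *)
Lemma minus_SR_F2 k mu (G : sgraph) :
    (0 < k)%N -> 1 < mu -> mu ^+ 2 = k%:R * mu + 1 -> minus_SR G ->
    let s := eigen_mult (adjmx G) in
  minus_SR (F2 k.+1 G) <->
  forall x,
    (s (x / mu)%R + s (- (x * mu))%R = s (x * mu)%R + s (- (x / mu))%R)%N.
Proof.
move=> k_gt0 mu_gt1 mu_root /minus_SR_mult[s0 SR] s; rewrite minus_SR_mult.
have [a multF2] := eigen_mult_F2 G k_gt0 mu_gt1 mu_root.
have inv_side x :
    eigen_mult (adjmx (F2 k.+1 G)) (- x^-1)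
    = (s (- x)%R * a + s (x * mu)%R + s (- (x / mu))%R)%N.
  rewrite multF2 /s -(SR (- x)) -(SR (x * mu)) -(SR (- (x / mu))).
  by rewrite !invrN !invfM invrK !mulNr !opprK.
split=> [[_ SRF] x|balanced].
  by have := SRF x; rewrite inv_side multF2 -!addnA => /addnI/esym.
split=> [|x].
  by rewrite multF2 !(mul0r, oppr0) s0.
by rewrite inv_side multF2 -!addnA -balanced.
Qed.

Lemma eigen_mult_bounded n (A : 'M[algC]_n) :
    (exists P d, diagonalizes P A d) ->
  exists N : nat, forall x, N%:R <= `|x| -> eigen_mult A x = 0%N.
Proof.
case=> P [d dA]; pose B := \sum_i `|d i|.
have B_ge0 : 0 <= B by apply: sumr_ge0 => i _; apply: normr_ge0.
exists (Num.bound B) => x x_big; rewrite (eigen_mult_diagonalizes _ dA).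
apply: big1 => i _; case: eqP => // dx.
have le_xB : `|x| <= B.
  rewrite -dx /B (bigD1 i) //= lerDl.
  by apply: sumr_ge0 => j _; apply: normr_ge0.
have := lt_le_trans (archi_boundP B_ge0) (le_trans x_big le_xB).
by rewrite ltxx.
Qed.

(** * Even spectra and bipartite graphs *)

(** Putting [x = y mu], the excess [s y - s (- y)] is unchanged when [y] is
    multiplied by [mu ^ 2].  Iterating leads out of the finite support of
    [s], so the excess is zero. *)
Lemma balanced_even (s : algC -> nat) (mu : algC) N :
    1 < mu -> (forall x, N%:R <= `|x| -> s x = 0%N) ->
  (forall x,
    (s (x / mu)%R + s (- (x * mu))%R = s (x * mu)%R + s (- (x / mu))%R)%N) <->
  (forall x, s (- x) = s x).
Proof.
move=> mu_gt1 s_fin; split=> [balanced x | even x]; last first.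
  by rewrite !even addnC.
have mu_gt0 : 0 < mu by apply: lt_trans mu_gt1.
have nz_mu : mu != 0 by rewrite gt_eqF.
have step y : (s y + s (- (y * mu ^+ 2))%R = s (y * mu ^+ 2)%R + s (- y)%R)%N.
  by have := balanced (y * mu); rewrite mulfK // expr2 mulrA.
have [->|nz_x] := eqVneq x 0; first by rewrite oppr0.
have chain (a b c d e f : nat) :
  (a + d = c + b -> c + f = e + d -> a + f = e + b)%N by lia.
have iter k : (s x + s (- (x * mu ^+ 2 ^+ k))%R
                = s (x * mu ^+ 2 ^+ k)%R + s (- x)%R)%N.
  elim: k => [|k IHk]; first by rewrite expr0 mulr1.
  by have := step (x * mu ^+ 2 ^+ k); rewrite -mulrA -exprSr; apply: chain.
have [k big_k] : exists k : nat, N%:R <= `|x * mu ^+ 2 ^+ k|.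
  have c_gt0 : 0 < mu - 1 by rewrite subr_gt0.
  have x_gt0 : 0 < `|x| by rewrite normr_gt0.
  (* Bernoulli's inequality makes the powers of mu unbounded. *)
  have pow_ge k : 1 + k%:R * (mu - 1) <= mu ^+ k.
    elim: k => [|k IHk]; first by rewrite mul0r addr0 expr0.
    rewrite exprSr; apply: le_trans (ler_wpM2r (ltW mu_gt0) IHk).
    rewrite -subr_ge0 -natr1.
    have -> : (1 + k%:R * (mu - 1)) * mu - (1 + (k%:R + 1) * (mu - 1))
              = k%:R * (mu - 1) ^+ 2 by ring.
    by rewrite mulr_ge0 ?ler0n // exprn_ge0 // ltW.
  have q_ge0 : 0 <= N%:R / (`|x| * (mu - 1)).
    by rewrite divr_ge0 ?ler0n // mulr_ge0 // ltW.
  exists (Num.bound (N%:R / (`|x| * (mu - 1)))).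
  set k := Num.bound _.
  have := ltW (archi_boundP q_ge0); rewrite -/k ler_pdivrMr ?mulr_gt0 // => le_k.
  apply: le_trans le_k _; rewrite normrM mulrCA ler_wpM2l ?normr_ge0 //.
  rewrite -exprM ger0_norm; last by rewrite exprn_ge0 // ltW.
  apply: (le_trans _ (le_trans (pow_ge k) _)); first by rewrite lerDr ler01.
  by rewrite ler_eXn2l // mulSn mul1n leq_addr.
have := iter k; rewrite (s_fin _ big_k) (s_fin (- _)) ?normrN //.
by rewrite addn0.
Qed.

(** Changing the signs of the coordinates in one colour class conjugates the
    adjacency matrix to its opposite. *)
Lemma bipartite_even_spectrum (G : sgraph) x :
  bipartite G -> eigen_mult (adjmx G) (- x) = eigen_mult (adjmx G) x.
Proof.
case=> X bipX; have [P [d dA]] := adjmx_diagonalizes G.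
pose D : 'M[algC]_#|G| := diag_mx (\row_i (-1) ^+ (enum_val i \in X)).
have D2 : D *m D = 1%:M.
  rewrite mulmx_diag; apply/matrixP=> i j; rewrite !mxE.
  by rewrite -expr2 sqrr_sign.
have [Du _] := mulmx1_unit D2.
have DA : D *m adjmx G = (- adjmx G) *m D.
  rewrite mul_diag_mx mul_mx_diag; apply/matrixP=> i j; rewrite !mxE.
  case Aij: (adj _ _); last by rewrite oppr0 mul0r mulr0.
  have := bipX _ _ Aij; rewrite mulr1 mulN1r.
  by case: (_ \in X); case: (_ \in X) => //= _; rewrite ?opprK.
have dNA : diagonalizes P (- adjmx G) (fun i => - d i).
  case: dA => Pu PA; split=> //; rewrite mulmxN PA -mulNmx; congr (_ *m _).
  by apply/matrixP=> i j; rewrite !mxE mulNrn.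
rewrite {2}/eigen_mult (char_poly_similar Du DA) -/(eigen_mult _ _).
rewrite (eigen_mult_diagonalizes _ dA) (eigen_mult_diagonalizes _ dNA).
by apply: eq_bigr => i _; rewrite eqr_oppLR.
Qed.

(** Odd power sums of a multiset that is closed under negation vanish. *)
Lemma even_spectrum_trace n (P A : 'M[algC]_n) d k :
    diagonalizes P A d -> (forall x, eigen_mult A (- x) = eigen_mult A x) ->
  odd k -> \tr (A ^+ k) = 0.
Proof.
move=> dA even odd_k; rewrite (trace_diagonalizes (diagonalizes_exp k dA)).
pose s1 := [seq d i | i : 'I_n]; pose s2 := [seq - d i | i : 'I_n].
have cnt (F : 'I_n -> algC) x :
    count_mem x [seq F i | i : 'I_n] = (\sum_i (F i == x))%N.
  rewrite count_map -sum1_count big_enum_cond big_mkcond /=.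
  by apply: eq_bigr => i _; case: eqP.
have perm12 : perm_eq s1 s2.
  apply/allP=> x _ /=; rewrite !cnt -(eigen_mult_diagonalizes _ dA) -even.
  rewrite (eigen_mult_diagonalizes _ dA); apply/eqP; apply: eq_bigr => i _.
  by rewrite eqr_oppLR.
have : \sum_(y <- s1) y ^+ k = \sum_(y <- s2) y ^+ k by apply: perm_big.
rewrite !big_image /=.
under [RHS]eq_bigr do rewrite exprNn -signr_odd odd_k expr1 mulN1r.
by rewrite sumrN => /eqP; rewrite -addr_eq0 -mulr2n mulrn_eq0 => /eqP.
Qed.

Lemma adjmx_exp_ge0 (G : sgraph) k i j : 0 <= (adjmx G ^+ k) i j.
Proof.
elim: k i j => [|k IHk] i j; first by rewrite expr0 mxE ler0n.
rewrite exprS mxE; apply: sumr_ge0 => l _.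
by rewrite mulr_ge0 // mxE ler0n.
Qed.

Lemma adjmx_exp_walk (G : sgraph) (u : G) p :
  path (@adj G) u p ->
  0 < (adjmx G ^+ size p) (enum_rank u) (enum_rank (last u p)).
Proof.
elim: p u => [|v p IHp] u /=; first by rewrite expr0 mxE eqxx ltr01.
case/andP=> uv /IHp walk; rewrite exprS mxE (bigD1 (enum_rank v)) //=.
apply: ltr_wpDr.
  by apply: sumr_ge0 => l _; rewrite mulr_ge0 ?adjmx_exp_ge0 // mxE ler0n.
by rewrite mxE !enum_rankK uv mul1r.
Qed.

(** A closed walk of length [k] at [u] makes the [u]-th diagonal entry of the
    [k]-th power positive, while all the diagonal entries are nonnegative;
    their sum, a trace, is zero for odd [k]. *)
Lemma even_spectrum_no_odd_cycle (G : sgraph) (u : G) p :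
    (forall x, eigen_mult (adjmx G) (- x) = eigen_mult (adjmx G) x) ->
  path (@adj G) u p -> last u p = u -> ~~ odd (size p).
Proof.
move=> even walk closed; apply/negP=> odd_p.
have [P [d dA]] := adjmx_diagonalizes G.
have /eqP := even_spectrum_trace dA even odd_p.
rewrite psumr_eq0 => [/allP/(_ (enum_rank u))|i _]; last exact: adjmx_exp_ge0.
have := adjmx_exp_walk walk; rewrite closed => /lt0r_neq0/negPf->.
by rewrite mem_index_enum => /(_ isT).
Qed.

(** Colour each vertex by the parity of a chosen walk from a root.  If two
    adjacent vertices had the same colour, the two chosen walks and the edge
    between them would form a closed walk of odd length. *)
Lemma no_odd_cycle_bipartite (G : sgraph) :
    connected_graph G ->
    (forall (u : G) p, path (@adj G) u p -> last u p = u -> ~~ odd (size p)) ->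
  bipartite G.
Proof.
case=> /card_gt0P[r _] conn no_odd.
have walk_to v : {p | path (@adj G) r p & last r p == v}.
  have /connectP := conn r v => ex.
  apply: sig2W; by case: ex => p wp ->; exists p.
exists [set v | odd (size (s2val (walk_to v)))] => u v uv; rewrite !inE.
case: (walk_to u) (walk_to v) => p wp elp [q wq elq] /=.
have lp := eqP elp; have lq := eqP elq.
have wq' : path (@adj G) v (rev (belast r q)).
  by rewrite -lq rev_path (eq_path (e' := @adj G)) // => y z; rewrite adj_sym.
have := no_odd r (p ++ v :: rev (belast r q)).
rewrite cat_path wp lp /= uv wq' last_cat /= => /(_ isT).
have -> : last v (rev (belast r q)) = r.
  case: (q) lq => [|w q'] //= _; by rewrite rev_cons last_rcons.
move=> /(_ erefl); rewrite size_cat /= size_rev size_belast addnS /= oddD.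
by case: (odd _); case: (odd _).
Qed.

Unset Implicit Arguments.
Local Close Scope ring_scope.

Theorem theorem5p6 (G : sgraph) (m : nat) (hG : connected_graph G)
    (hSR : minus_SR G) (hm : 3 <= m) :
  minus_SR (F2 m G) <-> bipartite G.
Proof.
case: m hm => [|k] // /ltnW k_gt0.
have [mu mu_gt1 mu_root] := F2_pattern_root k_gt0.
have [N s_fin] := eigen_mult_bounded (adjmx_diagonalizes G).
rewrite (minus_SR_F2 k_gt0 mu_gt1 mu_root hSR) (balanced_even mu_gt1 s_fin).
split=> [even|bip x]; last exact: bipartite_even_spectrum.
by apply: no_odd_cycle_bipartite hG _ => u p; apply: even_spectrum_no_odd_cycle.
Qed.
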